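(* Let $p,q,r>1$, $k\in[0,1)$ and $n\in\{0,1,2,\ldots\}$. Then the following hold. (1) For any $R\in(-1,q-1]$, with $u$ defined by $1/u:=(R+1)/q$, $$\int_0^{K_{p,q,r}(k)}\operatorname{sn}_{p,q,r}^{qn+R}(t,k)\,dt=\frac{(1/u)_n}{(R+1)(1/p^*+1/u)_n}\,\frac{\pi_{p,u}}{2}\,F\left(\frac1u+n,\frac1{r^*};\frac1{p^*}+\frac1u+n;k^q\right).$$ (2) For any $R\in(1-p,1]$, with $v$ defined by $1/v:=(R+p-1)/p$, $$\int_0^{K_{p,q,r}(k)}\operatorname{cn}_{p,q,r}^{pn+R}(t,k)\,dt=\frac{(1/v)_n}{(1/q+1/v)_n}\,\frac{\pi_{v^*,q}}{2}\,F\left(\frac1q,\frac1{r^*};\frac1q+\frac1v+n;k^q\right).$$ (3) For any $c\in\mathbb{R}$, $$\int_0^{K_{p,q,r}(k)}\operatorname{dn}_{p,q,r}^{c}(t,k)\,dt=\frac{\pi_{p,q}}{2}\,F\left(\frac1q,\frac{1-c}{r^*};\frac1{p^*}+\frac1q;k^q\right).$$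
   Context: For $s>1$, $s^*:=s/(s-1)$. For $p,q>1$, $\pi_{p,q}:=2\int_0^1(1-t^q)^{-1/p}\,dt=\frac2q B\left(\frac1{p^*},\frac1q\right)$, where $B$ is the beta function. Conventions for boundary values: $1^*:=\infty$, $\pi_{p,1}:=2p^*$, $\pi_{\infty,q}:=2$. For $p,q,r>1$ and $k\in[0,1)$ let $H_{p,q,r}(x,k):=\int_0^x\frac{dt}{(1-t^q)^{1/p}(1-k^qt^q)^{1-1/r}}$ for $x\in[0,1]$, and $K_{p,q,r}(k):=H_{p,q,r}(1,k)<\infty$. $H_{p,q,r}(\cdot,k)$ is an increasing bijection $[0,1]\to[0,K_{p,q,r}(k)]$; its inverse is $\operatorname{sn}_{p,q,r}(\cdot,k):[0,K_{p,q,r}(k)]\to[0,1]$. Further, $\operatorname{cn}_{p,q,r}(x,k):=(1-\operatorname{sn}_{p,q,r}^q(x,k))^{1/p}$ and $\operatorname{dn}_{p,q,r}(x,k):=(1-k^q\operatorname{sn}_{p,q,r}^q(x,k))^{1-1/r}$. A superscript on $\operatorname{sn},\operatorname{cn},\operatorname{dn}$ denotes a power. $(\zeta)_0:=1$, $(\zeta)_n:=\zeta(\zeta+1)\cdots(\zeta+n-1)$ for $n\ge1$. $F(\alpha,\beta;\gamma;x):=\sum_{n\ge0}\frac{(\alpha)_n(\beta)_n}{(\gamma)_n n!}x^n$ ($|x|<1$) is Gauss's hypergeometric series. *)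

(* Defs.v *)
From HB Require Import structures.
From mathcomp Require Import all_boot all_order all_algebra.
From mathcomp Require Import all_classical all_reals all_analysis.
Set Implicit Arguments.
Unset Strict Implicit.
Unset Printing Implicit Defensive.
Import Order.TTheory GRing.Theory Num.Theory.
Import numFieldNormedType.Exports.
Local Open Scope classical_set_scope.
Local Open Scope ring_scope.

(* [hoelder_conjugate s%:E] is s / (s - 1), with value +oo at s = 1;
   [conjr s] is the same number as a real, to be used only for s > 1. *)
Definition conjr {R : realType} (s : R) : R := fine (hoelder_conjugate s%:E).

(* pi_{p,q}. The first index may be +oo; the value at -oo is irrelevant. *)
Definition gpi {R : realType} (p : \bar R) (q : R) : R :=
  match p with
  | p0%:E =>
      if q == 1 then 2 * conjr p0
      else 2 * \int[@lebesgue_measure R]_(t in `[0, 1])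
                 ((1 - t `^ q) `^ (- p0^-1))
  | +oo%E => 2
  | -oo%E => 0
  end.

Section jacobi.
Context {R : realType}.
Implicit Types p q r k x : R.

(* At t = 1 the integrand takes the junk value 0 (x / 0 = 0); a null set. *)
Definition ellH p q r x k : R :=
  \int[@lebesgue_measure R]_(t in `[0, x])
    (((1 - t `^ q) `^ p^-1 * (1 - k `^ q * t `^ q) `^ (1 - r^-1))^-1).

Definition ellK p q r k : R := ellH p q r 1 k.

Definition sn p q r x k : R :=
  'pinv_(fun=> 0) `[0, 1] (fun y => ellH p q r y k) x.

Definition cn p q r x k : R := (1 - sn p q r x k `^ q) `^ p^-1.

Definition dn p q r x k : R :=
  (1 - k `^ q * sn p q r x k `^ q) `^ (1 - r^-1).

End jacobi.

Definition poch {R : realType} (z : R) (n : nat) : R :=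
  \prod_(i < n) (z + i%:R).

Definition hyp2F1 {R : realType} (a b c x : R) : R :=
  limn (series (fun n => poch a n * poch b n / (poch c n * n`!%:R) * x ^+ n)).

(* Main.v *)
(* Substituting x = sn t turns each integral over [0, K] into an integral over
   ]0, 1[ of a product of powers of x, 1 - x^q and 1 - k^q x^q, and s = x^q
   turns that into Euler's integral
     int_0^1 s^(z-1) (1-s)^(y-1) (1 - k^q s)^(-b) ds
       = B(z, y) F(z, b; z + y; k^q),
   which follows by integrating the binomial series of (1 - k^q s)^(-b) term by
   term (dominated convergence).  The factors (.)_n come from the recurrences
   of B, and pi_{p,u} / 2 = B(1/u, 1 - 1/p) / u. *)
Require Import Defs.
From HB Require Import structures.
From mathcomp Require Import all_boot all_order all_algebra.
From mathcomp Require Import all_classical all_reals all_analysis.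
From mathcomp Require Import measurable_realfun.
From mathcomp Require Import ring lra.
Set Implicit Arguments.
Unset Strict Implicit.
Unset Printing Implicit Defensive.
Import Order.TTheory GRing.Theory Num.Theory.
Import numFieldNormedType.Exports.
Local Open Scope classical_set_scope.
Local Open Scope ring_scope.

(** * Improper integrals and substitution *)

(** The integrands have negative exponents and may blow up at both ends of their interval, so the
    calculus is set up on open intervals: inside, continuity and nonnegativity; at the ends, only
    limits of a primitive or of the substitution map. Nonnegativity also turns a finite value of an
    integral into integrability. The three claims are one computation. The elliptic integrand is a
    product of powers of x, 1 - x^q and 1 - k^q x^q, and a power of sn, cn or dn changes exactly one
    of the three exponents. All of them are therefore instances of a single kernel with free
    parameters z, y, b. *)

Lemma continuous_oo_measurable (R : realType) (f : R -> R) (a b : R) :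
  {in `]a, b[, continuous f} -> measurable_fun `]a, b[ f.
Proof.
move=> cf; apply: open_continuous_measurable_fun => // x.
by rewrite inE => /cf.
Qed.

(** Monotone convergence along the compact intervals [[a + e n, b - e n]], on each of which the
    usual fundamental theorem applies. Nonnegativity takes the place of integrability, so [f] may be
    unbounded at both ends. *)
Lemma ge0_continuous_FTC2_oo (R : realType) (f F : R -> R) (a b A B : R) :
  a < b -> {in `]a, b[, forall x, 0 <= f x} -> {in `]a, b[, continuous f} ->
  {in `]a, b[, forall x : R, is_derive x 1 F (f x)} ->
  F x @[x --> a^'+] --> A -> F x @[x --> b^'-] --> B ->
  (\int[@lebesgue_measure R]_(x in `]a, b[) (f x)%:E = (B - A)%:E)%E.
Proof.
move=> ab f0 cf dF FA FB.
(* The shift by 3 gives [e n <= (b - a) / 3], so the intervals are nondegenerate from [n = 0] on. *)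
pose e (n : nat) : R := (b - a) / n.+3%:R.
have ba0 : 0 < b - a by rewrite subr_gt0.
have e0 n : 0 < e n by rewrite divr_gt0.
have e3 n : e n <= (b - a) / 3.
  by rewrite ler_pM2l// lef_pV2 ?posrE// ler_nat.
have ae n : a < a + e n by rewrite ltrDl.
have be n : b - e n < b by rewrite gtrDl oppr_lt0.
have abe n : a + e n < b - e n by have := e3 n; lra.
have e_ni m n : (m <= n)%N -> e n <= e m.
  by move=> mn; rewrite ler_pM2l// lef_pV2 ?posrE// ler_nat.
have ecv : e n @[n --> \oo] --> 0.
  rewrite -[X in _ --> X](mulr0 (b - a)); apply: cvgMr.
  have : (n%:R^-1 : R) @[n --> \oo] --> 0.
    apply/gtr0_cvgV0; first by exists 1%N => // n /= n0; rewrite ltr0n.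
    exact: cvgr_idn.
  rewrite -(cvg_shiftn 3); apply: cvg_trans; apply: near_eq_cvg; near=> n.
  by rewrite /= -?(addn3 n).
pose I n : set R := `[a + e n, b - e n]%classic.
have IU : \bigcup_n I n = `]a, b[%classic.
  apply/seteqP; split => x /=.
    move=> [n _]; rewrite /I /= !in_itv/= => /andP[x1 x2].
    by rewrite (lt_le_trans (ae n) x1) (le_lt_trans x2 (be n)).
  rewrite in_itv/= => /andP[ax xb].
  have d0 : 0 < Num.min (x - a) (b - x) by rewrite lt_min !subr_gt0 ax.
  move/cvgrPdist_lt : ecv => /(_ _ d0)[n _ /(_ n (leqnn n))].
  rewrite /= sub0r normrN gtr0_norm// lt_min => /andP[en1 en2].
  exists n => //; rewrite /I/= in_itv/=; apply/andP; split; lra.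
have Isub n x : x \in `[a + e n, b - e n] -> x \in `]a, b[.
  rewrite !in_itv/= => /andP[x1 x2].
  by rewrite (lt_le_trans (ae n) x1) (le_lt_trans x2 (be n)).
have cF x : x \in `]a, b[ -> {for x, continuous F}.
  move=> xab; have := dF x xab; move=> ?.
  by apply/differentiable_continuous/derivable1_diffP.
rewrite -IU.
have H1 : (\int[@lebesgue_measure R]_(x in I n) (f x)%:E)%E @[n --> \oo] -->
    (\int[@lebesgue_measure R]_(x in \bigcup_n I n) (f x)%:E)%E.
  apply: ge0_nondecreasing_set_cvg_integral => //.
  - move=> m n mn; rewrite subsetEset => x; rewrite /I/= !in_itv/= => /andP[x1 x2].
    have := e_ni _ _ mn => emn; apply/andP; split; lra.
  - by move=> i; exact: measurable_itv.
  - move=> i.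
    apply: measurable_funS (measurableT_comp _ (continuous_oo_measurable cf)) => //.
    by move=> x /Isub.
  - by move=> i x /Isub xab; rewrite lee_fin f0.
have H2 : ((F (b - e n) - F (a + e n))%:E)%E @[n --> \oo] --> ((B - A)%:E)%E.
  apply: cvg_EFin; first exact: nearW.
  apply: cvgB.
    have /cvg_at_leftP := FB; apply; split => //.
    by rewrite -[X in _ --> X](subr0 b); apply: cvgB => //; exact: cvg_cst.
  have /cvg_at_rightP := FA; apply; split => //.
  by rewrite -[X in _ --> X](addr0 a); apply: cvgD => //; exact: cvg_cst.
apply: (cvg_unique _ H1); first exact: ereal_hausdorff.
apply: cvg_trans H2; apply: near_eq_cvg; near=> n.
rewrite EFinB; apply/esym/continuous_FTC2 => //.
- apply: continuous_in_subspaceT => x; rewrite inE => /Isub; exact: cf.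
- split.
  + by move=> x /subset_itv_oo_cc /Isub xab; have := dF x xab.
  + apply: cvg_at_right_filter; apply: cF; apply: (@Isub n).
    by rewrite in_itv/= lexx ltW.
  + apply: cvg_at_left_filter; apply: cF; apply: (@Isub n).
    by rewrite in_itv/= lexx ltW.
- move=> x /subset_itv_oo_cc /Isub xab; have := dF x xab.
  by move=> ?; rewrite derive1E derive_val.
Unshelve. all: by end_near. Qed.

Lemma integrable_oo_cc (R : realType) (f : R -> R) (a b : R) :
  (@lebesgue_measure R).-integrable `]a, b[ (EFin \o f) ->
  (@lebesgue_measure R).-integrable `[a, b] (EFin \o f).
Proof.
move=> /integrableP[mf fi]; apply/integrableP; split.
  apply/emeasurable_fun_itv_obnd_cbndP/emeasurable_fun_itv_bndo_bndcP.
  exact: mf.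
rewrite (@integral_itv_bndoo _ a b _ true false)//.
exact: measurableT_comp.
Qed.

Lemma is_derive_primitive (R : realType) (f : R -> R) (a b : R) :
  (@lebesgue_measure R).-integrable `]a, b[ (EFin \o f) ->
  {in `]a, b[, continuous f} ->
  {in `]a, b[, forall x : R, is_derive x 1
    (fun x => \int[@lebesgue_measure R]_(t in `[a, x]) f t) (f x)}.
Proof.
move=> /integrable_oo_cc fi cf x xab.
have := xab; rewrite in_itv/= => /andP[ax xb].
have [|d1 d2] := @continuous_FTC1_closed _ f a x b xb fi ax.
  exact: cf.
by apply: DeriveDef => //; rewrite -derive1E.
Qed.

Lemma primitive_continuous (R : realType) (f : R -> R) (a b : R) : a <= b ->
  (@lebesgue_measure R).-integrable `]a, b[ (EFin \o f) ->
  {within `[a, b], continuous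
    (fun x => \int[@lebesgue_measure R]_(t in `[a, x]) f t)}.
Proof.
move=> ab /integrable_oo_cc fi.
exact: (@parameterized_integral_continuous _ a b f ab fi).
Qed.

Lemma cvg_within_image {T U : Type} (f : T -> U) (F : set_system T)
    (G : set_system U) (D : set U) : Filter F ->
  f @ F --> G -> (\forall x \near F, D (f x)) -> f @ F --> within D G.
Proof.
move=> FF fG fD P GP.
have := fG _ GP; rewrite /= /fmap /=; apply: filterS2 fD.
by move=> x Dx; exact.
Qed.

(** With [Psi] a primitive of [f], [Psi \o phi] is a primitive of the integrand on the left. Only
    limits of [phi] enter at the ends, so [f] and [dphi] may be unbounded there. *)
Lemma increasing_ge0_integration_by_substitution_oo (R : realType)
    (f phi dphi : R -> R) (a b c d : R) : a < b -> c < d ->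
  (@lebesgue_measure R).-integrable `]c, d[ (EFin \o f) ->
  {in `]c, d[, continuous f} -> {in `]c, d[, forall x, 0 <= f x} ->
  {in `]a, b[, continuous dphi} -> {in `]a, b[, forall x, 0 <= dphi x} ->
  {in `]a, b[, forall x, phi x \in `]c, d[} ->
  {in `]a, b[, forall x : R, is_derive x 1 phi (dphi x)} ->
  phi x @[x --> a^'+] --> c -> phi x @[x --> b^'-] --> d ->
  (\int[@lebesgue_measure R]_(x in `]a, b[) (f (phi x) * dphi x)%:E
   = \int[@lebesgue_measure R]_(x in `]c, d[) (f x)%:E)%E.
Proof.
move=> ab cd fi cf f0 cdphi dphi0 phicd Dphi phic phid.
pose Psi x := \int[@lebesgue_measure R]_(t in `[c, x]) f t.
have DPsi := is_derive_primitive fi cf.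
have /(continuous_within_itvP _ cd)[_ Psic Psid] := primitive_continuous (ltW cd) fi.
rewrite (@ge0_continuous_FTC2_oo _ _ (Psi \o phi) a b (Psi c) (Psi d)) //.
- rewrite /Psi set_itv1 Rintegral_set1 subr0 /Rintegral.
  rewrite (@integral_itv_bndoo _ c d _ true false); last first.
    by apply: measurableT_comp => //; exact: continuous_oo_measurable.
  by rewrite fineK//; apply: integrable_fin_num fi.
- by move=> x xab; rewrite mulr_ge0// ?dphi0// f0// phicd.
- move=> x xab; apply: cvgM; last exact: cdphi.
  apply: continuous_comp; last exact/cf/phicd.
  have := Dphi x xab => ?.
  by apply/differentiable_continuous/derivable1_diffP.
- by move=> x xab; apply: is_derive1_comp; [apply/DPsi/phicd|exact: Dphi].
(* [Psi] is known to be continuous at [c] only from the right; the limit of [phi] is one-sided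
   because [phi] takes its values in []c, d[]. *)
- apply: (@cvg_comp _ _ _ phi Psi _ c^'+) => //.
  apply: cvg_within_image => //; near=> x.
  suff /phicd : x \in `]a, b[ by rewrite in_itv/= => /andP[].
  by rewrite in_itv/=; apply/andP.
- apply: (@cvg_comp _ _ _ phi Psi _ d^'-) => //.
  apply: cvg_within_image => //; near=> x.
  suff /phicd : x \in `]a, b[ by rewrite in_itv/= => /andP[].
  by rewrite in_itv/=; apply/andP.
Unshelve. all: by end_near. Qed.

(** The substitution x = S(t) for the inverse S of a primitive H of f: since S' = 1/f(S), the factor
    f cancels. For [sn], [f] is the elliptic integrand and [g] gives the power being integrated. *)
Lemma integral_comp_pinv_primitive (R : realType) (f g : R -> R) (a b : R)
    (H := fun y => \int[@lebesgue_measure R]_(t in `[a, y]) f t) :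
  a < b -> (@lebesgue_measure R).-integrable `]a, b[ (EFin \o f) ->
  {in `]a, b[, continuous f} -> {in `]a, b[, forall x, 0 < f x} ->
  {in `]a, b[, continuous g} -> {in `]a, b[, forall x, 0 <= g x} ->
  (@lebesgue_measure R).-integrable `]a, b[ (EFin \o (g \* f)) ->
  (\int[@lebesgue_measure R]_(t in `[0%R, H b])
     (g ('pinv_(fun=> 0%R) `[a, b] H t))%:E =
   \int[@lebesgue_measure R]_(x in `]a, b[) (g x * f x)%:E)%E.
Proof.
move=> ab fi cf f0 cg g0 gfi; set S := 'pinv_(fun=> 0) `[a, b] H.
have cH : {within `[a, b], continuous H} by exact: primitive_continuous (ltW ab) fi.
have dH := is_derive_primitive fi cf; rewrite -/H in dH.
have Ha : H a = 0 by rewrite /H set_itv1 Rintegral_set1.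
have Hmono : {in `[a, b] &, {homo H : x y / x < y}}.
  move=> x y; rewrite !in_itv/= => /andP[ax xb] /andP[ay yb] xy.
  have sub : {subset `]x, y[ <= `]a, b[}.
    move=> z; rewrite !in_itv/= => /andP[xz zy].
    by rewrite (le_lt_trans ax xz) (lt_le_trans zy yb).
  have [||z zxy] := @MVT _ H f x y xy; [by move=> z /sub /dH| |].
    apply: continuous_subspaceW cH => z /=; rewrite !in_itv/= => /andP[xz zy].
    by rewrite (le_trans ax xz) (le_trans zy yb).
  move=> e; rewrite -subr_gt0 e mulr_gt0 ?subr_gt0//.
  by apply: f0; exact: sub.
have HS : {in `[a, b], cancel H S}.
  have Hinj : {in `[a, b]%classic &, injective H}.
    move=> x y; rewrite !inE/= => xab yab Hxy; apply/eqP.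
    by case: ltgtP => // /Hmono; [move=> /(_ xab yab)|move=> /(_ yab xab)];
      rewrite Hxy ltxx.
  move=> x xab.
  by apply: (@pinvKV _ _ (fun=> 0) `[a, b]%classic H Hinj); rewrite inE.
have aab : a \in `[a, b] by rewrite in_itv/= lexx ltW.
have bab : b \in `[a, b] by rewrite in_itv/= lexx ltW.
have Hb : 0 < H b by rewrite -Ha Hmono.
have HK t : t \in `]0, H b[ -> exists2 x, x \in `]a, b[ & H x = t.
  rewrite in_itv/= => /andP[t0 tb].
  have /(IVT (ltW ab) cH)[x xab xt] :
      Num.min (H a) (H b) <= t <= Num.max (H a) (H b).
    by rewrite Ha (min_idPl (ltW Hb)) (max_idPr (ltW Hb)) !ltW.
  exists x => //; move: xab; rewrite !in_itv/= !le_eqVlt => /andP[].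
  move=> /predU1P[ax|->]; first by move: t0; rewrite -xt -ax Ha ltxx.
  by move=> /predU1P[xb|->//]; move: tb; rewrite -xt xb ltxx.
have Sab t : t \in `]0, H b[ -> S t \in `]a, b[.
  by move=> /HK[x xab <-]; rewrite HS//; exact: subset_itv_oo_cc.
(* The inverse is continuous up to the ends of its segment, which supplies the limits [a] and [b] of
   [S] that the substitution requires. *)
have := segment_can_le_continuous (ltW ab) cH HS.
rewrite Ha => /(continuous_within_itvP _ Hb)[cS].
have -> : S 0 = a by rewrite -Ha HS.
rewrite HS// => S0 Sb.
have dS t : t \in `]0, H b[ -> is_derive t 1 S (f (S t))^-1.
  move=> /HK[x xab <-]; rewrite HS ?subset_itv_oo_cc//.
  apply: is_derive_inverse.
  - near=> y; apply: HS; apply: subset_itv_oo_cc; near: y.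
    exact: near_in_itvoo.
  - near=> y.
    have yab : y \in `]a, b[ by near: y; exact: near_in_itvoo.
    have := dH y yab => ?.
    by apply/differentiable_continuous/derivable1_diffP.
  - exact: dH.
  - by rewrite gt_eqF// f0.
have cfS t : t \in `]0, H b[ -> {for t, continuous (f \o S)}.
  by move=> tb; apply: continuous_comp; [exact: cS|exact/cf/Sab].
rewrite (@integral_itv_bndoo _ 0 (H b) _ true false); last first.
  apply: measurableT_comp => //; apply: continuous_oo_measurable => t tb.
  by apply: continuous_comp; [exact: cS|exact/cg/Sab].
(* Used from right to left, on [g \* f] with [phi := S], so that []a, b[] becomes []0, H b[]. *)
rewrite -(@increasing_ge0_integration_by_substitution_oo _ (g \* f) S
  (fun t => (f (S t))^-1) 0 (H b))//.
- apply: eq_integral => t; rewrite inE /= => tb.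
  by rewrite mulfK// gt_eqF// f0// Sab.
- by move=> x xab; apply: cvgM; [exact: cg|exact: cf].
- by move=> x xab; rewrite mulr_ge0 ?g0// ltW// f0.
- move=> t tb; apply: cvgV; last exact: cfS.
  by rewrite gt_eqF// f0// Sab.
- by move=> t tb; rewrite invr_ge0 ltW// f0// Sab.
Unshelve. all: by end_near. Qed.

(** * The binomial series *)

Lemma is_derive_onem_powR (R : realType) (b x : R) : x < 1 ->
  is_derive x (1 : R) (fun x => (1 - x) `^ b) (- (b * (1 - x) `^ (b - 1))).
Proof.
move=> x1.
suff : is_derive x (1 : R) (fun x => (1 - x) `^ b) (b * (1 - x) `^ (b - 1) * -1).
  by rewrite mulrN1.
apply: (@is_derive1_comp _ (fun t => t `^ b) (fun t => 1 - t)).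
  by apply: is_derive1_powR; rewrite subr_gt0.
by apply: is_derive_eq; rewrite add0r mul1r.
Qed.

Lemma powR_mulS (R : realType) (x b : R) : 0 < x -> x `^ (b + 1) = x * x `^ b.
Proof.
by move=> x0; rewrite powRD ?(gt_eqF x0) ?implybT// powRr1 ?ltW// mulrC.
Qed.

Lemma is_derive0_eq (R : realType) (g : R -> R) (a b : R) : a <= b ->
  {in `[a, b], forall x : R, is_derive x 1 g 0} -> g b = g a.
Proof.
rewrite le_eqVlt => /predU1P[->//|ab] dg.
have [||z _] := @MVT _ g (fun=> 0) a b ab.
- by move=> z /subset_itv_oo_cc; exact: dg.
- by apply: derivable_within_continuous => z zab; have := dg z zab; case.
- by rewrite mul0r => /eqP; rewrite subr_eq0 => /eqP.
Qed.

Section Pochhammer.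
Context {R : realType}.
Implicit Types (a b z x : R) (m n : nat).

Lemma poch0 z : poch z 0 = 1.
Proof. by rewrite /poch big_ord0. Qed.

Lemma pochS z n : poch z n.+1 = poch z n * (z + n%:R).
Proof. by rewrite /poch big_ord_recr. Qed.

Lemma pochD z m n : poch z (m + n) = poch z m * poch (z + m%:R) n.
Proof.
elim: n => [|n IH]; first by rewrite addn0 poch0 mulr1.
by rewrite addnS !pochS IH natrD; ring.
Qed.

Lemma pochSl z n : poch z n.+1 = z * poch (z + 1) n.
Proof. by rewrite -add1n pochD pochS poch0 addr0 mul1r. Qed.

Lemma poch_gt0 z n : 0 < z -> 0 < poch z n.
Proof. by move=> z0; apply: prodr_gt0 => i _; rewrite ltr_wpDr. Qed.

(** Bounds binomial coefficients with a real parameter by those with an integer one, and gives (a)_n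
    / (c)_n <= 1 for 0 < a <= c. *)
Lemma ler_norm_poch b c n : `|b| <= c -> `|poch b n| <= poch c n.
Proof.
move=> bc; elim: n => [|n IH]; first by rewrite !poch0 normr1.
rewrite !pochS normrM ler_pM//.
by rewrite (le_trans (ler_normD _ _))// normr_nat lerD2r.
Qed.

End Pochhammer.

Section binomial_series.
Context {R : realType}.
Implicit Types (b x : R) (m n : nat).

(* The coefficient of x^n in (1 - x)^(-b). *)
Definition binc b n : R := poch b n / n`!%:R.

Lemma binc0 b : binc b 0 = 1.
Proof. by rewrite /binc poch0 divr1. Qed.

Lemma fact_neq0 n : n`!%:R != 0 :> R.
Proof. by rewrite pnatr_eq0 -lt0n fact_gt0. Qed.

Lemma binc_ge0 b n : 0 <= b -> 0 <= binc b n.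
Proof.
move=> b0; rewrite divr_ge0// prodr_ge0// => i _.
by rewrite addr_ge0.
Qed.

(** On coefficients: the derivative of (1 - x)^(-b) is b (1 - x)^(-b-1). *)
Lemma bincS b n : n.+1%:R * binc b n.+1 = b * binc (b + 1) n.
Proof.
rewrite /binc pochSl factS natrM.
by field; rewrite fact_neq0 nat1r pnatr_eq0.
Qed.

Lemma bincSr b n : n.+1%:R * binc b n.+1 = (b + n%:R) * binc b n.
Proof.
rewrite /binc pochS factS natrM.
by field; rewrite fact_neq0 nat1r pnatr_eq0.
Qed.

(** On coefficients: (1 - x)^(-b) = (1 - x) (1 - x)^(-b-1). *)
Lemma binc_pascal b n : binc (b + 1) n.+1 = binc (b + 1) n + binc b n.+1.
Proof.
apply: (@mulfI _ n.+1%:R); first by rewrite pnatr_eq0.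
by rewrite mulrDr bincSr bincS -natr1; ring.
Qed.

(** Summing [binc_pascal] leaves a single boundary term. Its sign gives the bound in
    [is_cvg_binc_nat], its decay the identity [lim_binc_shift]. *)
Lemma series_binc b x n : series (fun i => binc b i * x ^+ i) n.+1 =
  (1 - x) * series (fun i => binc (b + 1) i * x ^+ i) n.+1
  + binc (b + 1) n * x ^+ n.+1.
Proof.
rewrite !seriesEord /=; elim: n => [|n IH].
  by rewrite !big_ord_recr /= !big_ord0 !binc0 expr0 expr1; ring.
rewrite big_ord_recr [in RHS]big_ord_recr /= IH binc_pascal.
by rewrite !exprS; ring.
Qed.



(** The terms are nonnegative, and by [series_binc] the partial sums satisfy (1 - x) S_(N+1) <= S_N;
    induction on [N] bounds them by (1 - x)^(-N). *)
Lemma is_cvg_binc_nat N x : 0 <= x < 1 ->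
  cvgn (series (fun i => binc (N%:R : R) i * x ^+ i)).
Proof.
move=> /andP[x0 x1].
have ge0 M i : 0 <= binc (M%:R : R) i * x ^+ i.
  by rewrite mulr_ge0 ?binc_ge0// exprn_ge0.
apply: nondecreasing_is_cvgn.
  by apply/nondecreasing_seqP => n; rewrite !seriesEnat/= big_nat_recr //= lerDl.
exists ((1 - x) ^- N) => _ [n _ <-].
elim: N n => [|N IH] [|n]; rewrite ?seriesEord /=.
- by rewrite big_ord0 expr0 invr1.
- rewrite big_ord_recl/= binc0 expr0 mulr1 big1 ?addr0 ?expr0 ?invr1// => i _.
  by rewrite /binc pochSl !mul0r.
- by rewrite big_ord0 invr_ge0 exprn_ge0// subr_ge0 ltW.
- rewrite exprSr invfM ler_pdivlMr ?subr_gt0// mulrC.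
  apply: le_trans (IH n.+1); rewrite series_binc seriesEord -natr1 lerDl.
  by rewrite natr1 mulr_ge0 ?binc_ge0// exprn_ge0.
Qed.

Lemma is_cvg_norm_binc b x : 0 <= x < 1 ->
  cvgn (series (fun i => `|binc b i| * x ^+ i)).
Proof.
move=> x01; have /andP[x0 x1] := x01.
apply: (@series_le_cvg _ _ (fun i => binc (Num.bound `|b|)%:R i * x ^+ i)).
- by move=> n; rewrite mulr_ge0// exprn_ge0.
- by move=> n; rewrite mulr_ge0 ?exprn_ge0// binc_ge0.
- move=> n; rewrite ler_wpM2r ?exprn_ge0// /binc normrM normfV normr_nat.
  rewrite ler_wpM2r ?invr_ge0//; apply: ler_norm_poch.
  by rewrite ltW// archi_boundP.
- exact: is_cvg_binc_nat.
Qed.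

Lemma is_cvg_binc b x : 0 <= x < 1 -> cvgn (pseries (binc b) x).
Proof.
move=> x01; apply: normed_cvg.
rewrite [X in cvgn X](_ : _ = series (fun i => `|binc b i| * x ^+ i)).
  exact: is_cvg_norm_binc.
apply/funext => n; rewrite /= !seriesEord; apply: eq_bigr => i _ /=.
by rewrite normrM normrX (ger0_norm (andP x01).1).
Qed.

Lemma pseries_diffs_binc b :
  pseries_diffs (binc b) = (fun i => b * binc (b + 1) i).
Proof. by apply/funext => i; rewrite /pseries_diffs bincS. Qed.

Lemma pseriesZ (c : R) (f : R^nat) x :
  pseries (fun i => c * f i) x = (fun n => c * pseries f x n).
Proof.
apply/funext => n; rewrite /pseries !seriesEord /= mulr_sumr.
by apply: eq_bigr => i _; rewrite mulrA.
Qed.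

Lemma is_derive_binc b x : 0 <= x < 1 ->
  is_derive x (1 : R) (fun x => limn (pseries (binc b) x))
    (b * limn (pseries (binc (b + 1)) x)).
Proof.
(* [pseries_snd_diffs] asks for convergence of the series and of its first two formal derivatives at
   a point beyond [x]; the midpoint of [x] and 1 serves, as these derivatives are again multiples of
   binomial series. *)
move=> /andP[x0 x1]; pose K := (x + 1) / 2.
have K01 : 0 <= K < 1 by rewrite /K; apply/andP; split; lra.
have xK : `|x| < `|K|.
  by rewrite !ger0_norm//; [rewrite /K; lra|case/andP: K01].
have -> : b * limn (pseries (binc (b + 1)) x) =
    limn (pseries (pseries_diffs (binc b)) x).
  rewrite pseries_diffs_binc pseriesZ; apply/esym/cvg_lim => //.
  by apply: cvgMr; apply: is_cvg_binc; rewrite x0.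
apply: (@pseries_snd_diffs _ (binc b) K) => //.
- exact: is_cvg_binc.
- by rewrite pseries_diffs_binc pseriesZ; apply: is_cvgMr; apply: is_cvg_binc.
- rewrite pseries_diffs_binc.
  have -> : pseries_diffs (fun i => b * binc (b + 1) i) =
      (fun i => b * (b + 1) * binc (b + 1 + 1) i).
    apply/funext => i; rewrite /pseries_diffs mulrCA bincS; ring.
  by rewrite pseriesZ; apply: is_cvgMr; apply: is_cvg_binc.
Qed.

Lemma lim_binc_shift b x : 0 <= x < 1 ->
  limn (pseries (binc b) x) = (1 - x) * limn (pseries (binc (b + 1)) x).
Proof.
move=> x01; have cb := @is_cvg_binc (b + 1) x x01.
apply/cvg_lim => //; rewrite -cvg_shiftS.
rewrite [X in X @ _ --> _](_ : _ = (fun n =>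
    (1 - x) * pseries (binc (b + 1)) x n.+1 + binc (b + 1) n * x ^+ n * x)).
  rewrite -[(1 - x) * limn _]addr0; apply: cvgD.
    by apply: cvgMr; rewrite (cvg_shiftS (pseries (binc (b + 1)) x)).
  have : (fun n => binc (b + 1) n * x ^+ n * x) @ \oo --> 0 * x.
    by apply: cvgMl; exact: cvg_series_cvg_0.
  by rewrite mul0r.
by apply/funext => n /=; rewrite -mulrA -exprSr -series_binc.
Qed.

Lemma cvg_binomial_series b x : 0 <= x < 1 ->
  series (fun i => binc b i * x ^+ i) @ \oo --> (1 - x) `^ (- b).
Proof.
move=> x01; have := @is_cvg_binc b x x01; rewrite /pseries.
suff : limn (pseries (binc b) x) = (1 - x) `^ (- b) by move=> <-.
have /andP[x0 x1] := x01.
(* g is constant, because f_b' = b f_(b+1) and f_b = (1 - t) f_(b+1). *)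
pose f b (t : R) := limn (pseries (binc b) t).
pose g t := f b t * (1 - t) `^ b.
have dg (t : R) : 0 <= t < 1 -> is_derive t 1 g 0.
  move=> t01; have /andP[t0 t1] := t01; have d1 := is_derive_binc b t01.
  have d2 := is_derive_onem_powR b t1.
  apply: (is_derive_eq (is_deriveM d1 d2)).
  rewrite lim_binc_shift// /GRing.scale /=.
  rewrite [(1 - t) `^ b](_ : _ = (1 - t) * (1 - t) `^ (b - 1)); first by ring.
  by rewrite -powR_mulS ?subr_gt0// subrK.
have g0 : g 0 = 1.
  rewrite /g subr0 powR1 mulr1; apply/cvg_lim => //.
  rewrite -cvg_shiftS; apply: cvg_near_cst; near=> n.
  rewrite /= /pseries seriesEord/= big_ord_recl/= binc0 expr0 mulr1.
  by rewrite big1 ?addr0// => i _; rewrite expr0n mulr0.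
have gx : g x = 1.
  rewrite -g0; apply: (is_derive0_eq x0) => z.
  by rewrite in_itv/= => /andP[z0 zx]; apply: dg; rewrite z0 (le_lt_trans zx).
have p0 : 0 < (1 - x) `^ b by rewrite powR_gt0// subr_gt0.
transitivity (g x / (1 - x) `^ b); first by rewrite /g mulfK ?gt_eqF.
by rewrite gx div1r powRN.
Unshelve. all: by end_near. Qed.

End binomial_series.

(** * The beta function *)

Lemma cvg_eq_lim (T : Type) (U : nbhsType) (f : T -> U) (F : set_system T)
    (l l' : U) : l = l' -> f @ F --> l -> f @ F --> l'.
Proof. by move=> ->. Qed.

Lemma powR_continuous (R : realType) (a x : R) : 0 < x ->
  {for x, continuous (fun x : R => x `^ a)}.
Proof.
move=> x0; have := is_derive1_powR a x0 => ?.
by apply/differentiable_continuous/derivable1_diffP.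
Qed.

Lemma onem_powR_continuous (R : realType) (a x : R) : x < 1 ->
  {for x, continuous (fun x : R => (1 - x) `^ a)}.
Proof.
move=> x1; have := is_derive_onem_powR a x1 => ?.
by apply/differentiable_continuous/derivable1_diffP.
Qed.

Lemma powR_cvg_at_left1 (R : realType) (a : R) :
  (x : R) `^ a @[x --> 1^'-] --> (1 : R).
Proof.
have : (x : R) `^ a @[x --> 1^'-] --> (1 : R) `^ a.
  by apply: cvg_at_left_filter; exact: powR_continuous.
by rewrite powR1.
Qed.

Lemma onem_powR_cvg_at_right0 (R : realType) (a : R) :
  (1 - x : R) `^ a @[x --> 0^'+] --> (1 : R).
Proof.
have : (1 - x : R) `^ a @[x --> 0^'+] --> (1 - 0 : R) `^ a.
  by apply: cvg_at_right_filter; exact: onem_powR_continuous.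
by rewrite subr0 powR1.
Qed.

Lemma onem_powR_cvg_at_left1 (R : realType) (a : R) : 0 < a ->
  (1 - x : R) `^ a @[x --> 1^'-] --> (0 : R).
Proof.
move=> a0; apply: (@cvg_comp _ _ _ (fun x : R => 1 - x) (fun x => x `^ a) _ 0^'+).
  apply: cvg_within_image.
    have : (1 - x : R) @[x --> 1^'-] --> (1 - 1 : R).
      by apply: cvg_at_left_filter; apply: cvgB => //; exact: cvg_cst.
    by rewrite subrr.
  by near=> x; rewrite /= subr_gt0.
exact: powR_cvg0.
Unshelve. all: by end_near. Qed.

Section beta.
Context {R : realType}.
Implicit Types (a b z y s : R) (n : nat).
Notation mu := (@lebesgue_measure R).

Definition beta_kernel z y s : R := s `^ (z - 1) * (1 - s) `^ (y - 1).

Definition betaf z y : R := \int[mu]_(s in `]0, 1[) beta_kernel z y s.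

Lemma beta_kernel_ge0 z y s : 0 <= beta_kernel z y s.
Proof. by rewrite mulr_ge0 ?powR_ge0. Qed.

Lemma beta_kernel_continuous z y : {in `]0, 1[, continuous (beta_kernel z y)}.
Proof.
move=> s; rewrite in_itv/= => /andP[s0 s1].
by apply: cvgM; [exact: powR_continuous|exact: onem_powR_continuous].
Qed.

(** Multiply by 1 = s + (1 - s). *)
Lemma beta_kernel_split z y s : 0 < s < 1 ->
  beta_kernel z y s = beta_kernel (z + 1) y s + beta_kernel z (y + 1) s.
Proof.
move=> /andP[s0 s1]; rewrite /beta_kernel (addrAC z) (addrAC y).
by rewrite !powR_mulS ?subr_gt0//; ring.
Qed.

Lemma integral_beta_kernel1r z : 0 < z ->
  (\int[mu]_(s in `]0%R, 1%R[) (beta_kernel z 1 s)%:E = (z^-1)%:E)%E.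
Proof.
move=> z0.
rewrite (@ge0_continuous_FTC2_oo _ _ (fun s => z^-1 * s `^ z) 0 1 0 z^-1)//.
- by rewrite subr0.
- by move=> s _; exact: beta_kernel_ge0.
- exact: beta_kernel_continuous.
- move=> s; rewrite in_itv/= => /andP[s0 s1].
  have d := is_derive1_powR z s0; apply: is_derive_eq.
  by rewrite /beta_kernel subrr powRr0 mulr1 /GRing.scale/= mulKf ?gt_eqF.
- apply: (cvg_eq_lim (mulr0 z^-1)); apply: cvgMr; exact: powR_cvg0.
- apply: (cvg_eq_lim (mulr1 z^-1)); apply: cvgMr; exact: powR_cvg_at_left1.
Qed.

Lemma integral_beta_kernel1l y : 0 < y ->
  (\int[mu]_(s in `]0%R, 1%R[) (beta_kernel 1 y s)%:E = (y^-1)%:E)%E.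
Proof.
move=> y0; rewrite (@ge0_continuous_FTC2_oo _ _
  (fun s => - y^-1 * (1 - s) `^ y) 0 1 (- y^-1) 0)//.
- by rewrite sub0r opprK.
- by move=> s _; exact: beta_kernel_ge0.
- exact: beta_kernel_continuous.
- move=> s; rewrite in_itv/= => /andP[s0 s1].
  have d := is_derive_onem_powR y s1; apply: is_derive_eq.
  rewrite /beta_kernel subrr powRr0 mul1r /GRing.scale/=.
  by rewrite mulrNN mulKf ?gt_eqF.
- apply: (cvg_eq_lim (mulr1 (- y^-1))); apply: cvgMr.
  exact: onem_powR_cvg_at_right0.
- apply: (cvg_eq_lim (mulr0 (- y^-1))); apply: cvgMr.
  exact: onem_powR_cvg_at_left1.
Qed.

Lemma measurable_beta_kernel z y :
  measurable_fun `](0 : R), (1 : R)[ (beta_kernel z y).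
Proof. by apply: continuous_oo_measurable; exact: beta_kernel_continuous. Qed.

Lemma integrable_beta_kernel z y : 0 < z -> 0 < y ->
  mu.-integrable `](0 : R), (1 : R)[ (EFin \o beta_kernel z y).
Proof.
have mk a b : measurable_fun `](0 : R), (1 : R)[ (EFin \o beta_kernel a b).
  by apply: measurableT_comp => //; exact: measurable_beta_kernel.
have norm_k a b s : (`|(EFin \o beta_kernel a b) s| = (beta_kernel a b s)%:E)%E.
  by rewrite /= ger0_norm// beta_kernel_ge0.
(* For [b >= 1] the factor (1 - s)^(b-1) is at most 1, which leaves s^(a-1) with its explicit
   primitive; [le2] is the mirror image. *)
have le1 a b : 0 < a -> 1 <= b ->
    mu.-integrable `](0 : R), (1 : R)[ (EFin \o beta_kernel a b).
  move=> a0 b1.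
  apply: (@le_integrable _ _ _ mu _ _ _ (EFin \o beta_kernel a 1)) => [||s|];
    rewrite ?inE; [by []|exact: mk| |].
    rewrite /= in_itv/= => /andP[s0 s1].
    rewrite lee_fin !ger0_norm ?beta_kernel_ge0// /beta_kernel subrr powRr0.
    rewrite ler_wpM2l ?powR_ge0// -[leRHS](powRr0 (1 - s)).
    by apply: ger_powR; rewrite ?subr_ge0// subr_gt0 s1 gerBl ltW.
  apply/integrableP; split; first exact: mk.
  by under eq_integral do rewrite norm_k; rewrite integral_beta_kernel1r ?ltry.
have le2 a b : 1 <= a -> 0 < b ->
    mu.-integrable `](0 : R), (1 : R)[ (EFin \o beta_kernel a b).
  move=> a1 b0.
  apply: (@le_integrable _ _ _ mu _ _ _ (EFin \o beta_kernel 1 b)) => [||s|];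
    rewrite ?inE; [by []|exact: mk| |].
    rewrite /= in_itv/= => /andP[s0 s1].
    rewrite lee_fin !ger0_norm ?beta_kernel_ge0// /beta_kernel subrr powRr0.
    rewrite ler_wpM2r ?powR_ge0// -[leRHS](powRr0 s).
    by apply: ger_powR; rewrite ?subr_ge0// s0 ltW.
  apply/integrableP; split; first exact: mk.
  by under eq_integral do rewrite norm_k; rewrite integral_beta_kernel1l ?ltry.
(* In kernel z y = kernel (z + 1) y + kernel z (y + 1) each summand has an
   exponent z + 1 or y + 1 above 1. *)
move=> z0 y0.
apply: (@eq_integrable _ _ _ mu _ _
  ((EFin \o beta_kernel (z + 1) y) \+ (EFin \o beta_kernel z (y + 1)))%E) => //.
  move=> s; rewrite inE/= in_itv/= => s01.
  by rewrite -EFinD -beta_kernel_split.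
by apply: integrableD => //; [apply: le2|apply: le1] => //; rewrite lerDr ltW.
Qed.

Lemma integral_beta_kernel z y : 0 < z -> 0 < y ->
  (\int[mu]_(s in `]0%R, 1%R[) (beta_kernel z y s)%:E = (betaf z y)%:E)%E.
Proof.
move=> z0 y0; rewrite /betaf /Rintegral fineK//.
exact: integrable_fin_num (integrable_beta_kernel z0 y0).
Qed.

Lemma betaf1r z : 0 < z -> betaf z 1 = z^-1.
Proof. by move=> z0; rewrite /betaf /Rintegral integral_beta_kernel1r. Qed.

Lemma betaf1l y : 0 < y -> betaf 1 y = y^-1.
Proof. by move=> y0; rewrite /betaf /Rintegral integral_beta_kernel1l. Qed.

Lemma betaf_split z y : 0 < z -> 0 < y ->
  betaf z y = betaf (z + 1) y + betaf z (y + 1).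
Proof.
move=> z0 y0; rewrite /betaf -RintegralD//; last 2 first.
- by apply: integrable_beta_kernel => //; rewrite addr_gt0.
- by apply: integrable_beta_kernel => //; rewrite addr_gt0.
by apply: eq_Rintegral => s; rewrite inE/= in_itv/= => /beta_kernel_split ->.
Qed.

Lemma betaf_by_parts z y : 0 < z -> 0 < y ->
  z * betaf z (y + 1) = y * betaf (z + 1) y.
Proof.
(* Adding y Psi, with Psi a primitive of s^z (1-s)^(y-1), to s^z (1-s)^y makes
   the derivative nonnegative, as ge0_continuous_FTC2_oo requires. *)
move=> z0 y0; have z1 : 0 < z + 1 by rewrite addr_gt0.
have y1 : 0 < y + 1 by rewrite addr_gt0.
pose Psi x := \int[mu]_(s in `[0%R, x]) beta_kernel (z + 1) y s.
have ik := integrable_beta_kernel z1 y0.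
have dPsi := is_derive_primitive ik (@beta_kernel_continuous (z + 1) y).
have /(continuous_within_itvP _ ltr01)[_ Psi0 Psi1] := primitive_continuous ler01 ik.
have : (\int[mu]_(s in `]0%R, 1%R[) (z * beta_kernel z (y + 1) s)%:E =
    (y * Psi 1 - y * Psi 0)%:E)%E.
  apply: (@ge0_continuous_FTC2_oo _ _
     (fun s => s `^ z * (1 - s) `^ y + y * Psi s)) => //.
  - by move=> s _; rewrite mulr_ge0 ?beta_kernel_ge0// ltW.
  - by move=> s s01; apply: cvgMr; exact: beta_kernel_continuous.
  - move=> s s01; have := s01; rewrite in_itv/= => /andP[s0 s1].
    have d1 := is_derive1_powR z s0; have d2 := is_derive_onem_powR y s1.
    have d3 := dPsi s s01; rewrite -/Psi in d3.
    apply: is_derive_eq; rewrite /GRing.scale/= /beta_kernel !addrK; ring.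
  - apply: (cvg_eq_lim (add0r _)); apply: cvgD; last exact: cvgMr.
    apply: (cvg_eq_lim (mul0r (1 : R))); apply: cvgM; first exact: powR_cvg0.
    exact: onem_powR_cvg_at_right0.
  - apply: (cvg_eq_lim (add0r _)); apply: cvgD; last exact: cvgMr.
    apply: (cvg_eq_lim (mulr0 (1 : R))); apply: cvgM; first exact: powR_cvg_at_left1.
    exact: onem_powR_cvg_at_left1.
under eq_integral do rewrite EFinM.
rewrite integralZl//; last exact: integrable_beta_kernel.
rewrite integral_beta_kernel// -EFinM => -[->].
rewrite /Psi set_itv1 Rintegral_set1 mulr0 subr0; congr (_ * _).
rewrite /betaf /Rintegral (@integral_itv_bndoo _ 0 1 _ true false)//.
by apply: measurableT_comp => //; exact: measurable_beta_kernel.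
Qed.

(** Eliminate B(z, y + 1) between [betaf_split] and [betaf_by_parts]. *)
Lemma betaf_recl z y : 0 < z -> 0 < y ->
  (z + y) * betaf (z + 1) y = z * betaf z y.
Proof.
move=> z0 y0; rewrite [betaf z y]betaf_split// mulrDr.
by rewrite betaf_by_parts// mulrDl.
Qed.

Lemma betaf_recr z y : 0 < z -> 0 < y ->
  (z + y) * betaf z (y + 1) = y * betaf z y.
Proof.
move=> z0 y0; rewrite [betaf z y]betaf_split// mulrDr.
by rewrite -betaf_by_parts// mulrDl.
Qed.

Lemma betaf_addnl z y n : 0 < z -> 0 < y ->
  betaf (z + n%:R) y = poch z n / poch (z + y) n * betaf z y.
Proof.
move=> z0 y0; elim: n => [|n IH]; first by rewrite !poch0 addr0 divr1 mul1r.
have zn : 0 < z + n%:R by rewrite ltr_wpDr.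
have zyn : z + y + n%:R != 0 by rewrite gt_eqF// ltr_wpDr// addr_gt0.
have pzy := poch_gt0 n (addr_gt0 z0 y0).
apply: (@mulfI _ (z + n%:R + y)); first by rewrite addrAC.
rewrite -natr1 addrA betaf_recl// IH !pochS.
by field; rewrite zyn gt_eqF.
Qed.

Lemma betaf_addnr z y n : 0 < z -> 0 < y ->
  betaf z (y + n%:R) = poch y n / poch (z + y) n * betaf z y.
Proof.
move=> z0 y0; elim: n => [|n IH]; first by rewrite !poch0 addr0 divr1 mul1r.
have yn : 0 < y + n%:R by rewrite ltr_wpDr.
have zyn : z + y + n%:R != 0 by rewrite gt_eqF// ltr_wpDr// addr_gt0.
have pzy := poch_gt0 n (addr_gt0 z0 y0).
apply: (@mulfI _ (z + (y + n%:R))); first by rewrite addrA.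
rewrite -natr1 (addrA y) betaf_recr// IH !pochS.
by field; rewrite zyn gt_eqF.
Qed.

End beta.

(** * Euler's integral *)

Section euler.
Context {R : realType}.
Implicit Types (a b c z y x s : R) (n : nat).
Notation mu := (@lebesgue_measure R).

(** Isolates the ratio (a)_n / (c)_n, which for c = a + y is B(a + n, y) / B(a, y), from a term of
    the binomial series. *)
Lemma hyp2F1_termE a b c x n :
  poch a n * poch b n / (poch c n * n`!%:R) * x ^+ n =
  poch a n / poch c n * (binc b n * x ^+ n).
Proof. by rewrite /binc invfM; ring. Qed.

Lemma is_cvg_hyp2F1 a b c x : 0 < a -> a <= c -> 0 <= x < 1 ->
  cvgn (series (fun n =>
    poch a n * poch b n / (poch c n * n`!%:R) * x ^+ n)).
Proof.
move=> a0 ac x01; have /andP[x0 x1] := x01.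
have c0 := lt_le_trans a0 ac.
apply: normed_cvg.
apply: (@series_le_cvg _ _ (fun n => `|binc b n| * x ^+ n))  => [n|n|n|].
- exact: normr_ge0.
- by rewrite mulr_ge0 ?exprn_ge0.
- rewrite /= hyp2F1_termE normrM -[leRHS]mul1r [X in _ * X]normrM.
  rewrite (ger0_norm (exprn_ge0 _ x0)) ler_wpM2r ?mulr_ge0 ?exprn_ge0//.
  rewrite ger0_norm; last by apply: divr_ge0; apply: ltW; apply: poch_gt0.
  rewrite ler_pdivrMr ?poch_gt0// mul1r -[leLHS]gtr0_norm ?poch_gt0//.
  by apply: ler_norm_poch; rewrite gtr0_norm.
- exact: is_cvg_norm_binc.
Qed.

Lemma beta_kernelX z y s n : 0 < s ->
  beta_kernel z y s * s ^+ n = beta_kernel (z + n%:R) y s.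
Proof.
move=> s0; rewrite /beta_kernel (addrAC z).
rewrite [s `^ (z - 1 + _)]powRD ?(gt_eqF s0) ?implybT//.
by rewrite powR_mulrn ?ltW//; ring.
Qed.

Definition euler_kernel z y b x s : R :=
  beta_kernel z y s * (1 - x * s) `^ (- b).

Lemma onemM_gt0 x s : 0 <= x < 1 -> 0 < s < 1 -> 0 <= x * s < 1.
Proof.
move=> /andP[x0 x1] /andP[s0 s1]; rewrite mulr_ge0 ?(ltW s0)//=.
by rewrite (le_lt_trans _ x1)// ler_piMr// ltW.
Qed.

Lemma euler_kernel_continuous z y b x : 0 <= x < 1 ->
  {in `]0, 1[, continuous (euler_kernel z y b x)}.
Proof.
move=> x01 s s01; apply: cvgM; first exact: beta_kernel_continuous.
move: s01; rewrite in_itv/= => /(onemM_gt0 x01)/andP[_ xs1].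
apply: (@continuous_comp _ _ _ ( *%R x) (fun t => (1 - t) `^ (- b))).
  exact: mulrl_continuous.
exact: onem_powR_continuous.
Qed.

Lemma euler_kernel_ge0 z y b x s : 0 <= euler_kernel z y b x s.
Proof. by rewrite mulr_ge0 ?powR_ge0 ?beta_kernel_ge0. Qed.

(** For [b < 0] and [x > 0] the binomial series has terms of both signs, which rules out monotone
    convergence. Integrability is part of the conclusion because the substitution s = t^q requires
    it. *)
Lemma euler_integral z y b x : 0 < z -> 0 < y -> 0 <= x < 1 ->
  mu.-integrable `](0 : R), (1 : R)[ (EFin \o euler_kernel z y b x) /\
  (\int[mu]_(s in `]0%R, 1%R[) (euler_kernel z y b x s)%:E =
   (betaf z y * hyp2F1 z b (z + y) x)%:E)%E.
Proof.
move=> z0 y0 x01; have /andP[x0 x1] := x01.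
have zn n : 0 < z + n%:R by rewrite ltr_wpDr.
pose c n := binc b n * x ^+ n.
(* As 0 < s < 1, [C] bounds all partial sums of the series at x s uniformly in s, so [C] times the
   beta kernel is an integrable majorant. *)
pose C := limn (series (fun n => `|binc b n| * x ^+ n)).
pose f_ n s : \bar R := (\sum_(i < n) (c i)%:E * (beta_kernel (z + i%:R) y s)%:E)%E.
have if_ n : mu.-integrable `](0 : R), (1 : R)[ (f_ n).
  apply: integrable_sum => // i _; apply: integrableZl => //.
  exact: integrable_beta_kernel.
have f_E n s : 0 < s < 1 -> f_ n s =
    (beta_kernel z y s * series (fun i => binc b i * (x * s) ^+ i) n)%:E.
  move=> /andP[s0 s1]; rewrite /f_ seriesEord/= mulr_sumr -sumEFin.
  apply: eq_bigr => i _; rewrite -EFinM -beta_kernelX// exprMn /c.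
  by congr EFin; ring.
(* Each factor s^i raises [z] to [z + i], and [betaf_addnl] turns this into (z)_i / (z + y)_i. *)
have int_f n : (\int[mu]_(s in `]0%R, 1%R[) f_ n s)%E =
    (betaf z y * series (fun n =>
    poch z n * poch b n / (poch (z + y) n * n`!%:R) * x ^+ n) n)%:E.
  rewrite integral_sum//; last first.
    by move=> i; apply: integrableZl => //; exact: integrable_beta_kernel.
  rewrite seriesEord/= mulr_sumr -sumEFin; apply: eq_bigr => i _.
  rewrite integralZl//; last exact: integrable_beta_kernel.
  rewrite integral_beta_kernel// betaf_addnl// hyp2F1_termE -EFinM /c.
  by congr EFin; ring.
have mf_ n : measurable_fun `](0 : R), (1 : R)[ (f_ n).
  by have /integrableP[] := if_ n.
have mf : measurable_fun `](0 : R), (1 : R)[ (EFin \o euler_kernel z y b x).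
  apply: measurableT_comp => //; apply: continuous_oo_measurable.
  exact: euler_kernel_continuous.
have ff : {ae mu, forall s, `]0, 1[%classic s ->
    f_ ^~ s @ \oo --> (EFin \o euler_kernel z y b x) s}.
  apply: aeW => s /=; rewrite in_itv/= => s01.
  under eq_cvg do rewrite f_E//.
  apply: cvg_EFin; first exact: nearW.
  apply: cvgMr; apply: cvg_binomial_series; exact: onemM_gt0.
have ig : mu.-integrable `](0 : R), (1 : R)[
    (fun s => C%:E * (beta_kernel z y s)%:E)%E.
  by apply: integrableZl => //; exact: integrable_beta_kernel.
have fg : {ae mu, forall s n, `]0, 1[%classic s ->
    (`|f_ n s| <= C%:E * (beta_kernel z y s)%:E)%E}.
  apply: aeW => s n /=; rewrite in_itv/= => s01; rewrite f_E//.
  rewrite -EFinM /= lee_fin normrM ger0_norm ?beta_kernel_ge0//.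
  rewrite [leRHS]mulrC ler_wpM2l ?beta_kernel_ge0//.
  have nd : nondecreasing_seq (series (fun i => `|binc b i| * x ^+ i)).
    apply/nondecreasing_seqP => m; rewrite !seriesEnat/= big_nat_recr//= lerDl.
    by rewrite mulr_ge0// exprn_ge0.
  have hC := @nondecreasing_cvgn_le _ _ nd (is_cvg_norm_binc (b:=b) x01) n.
  apply: le_trans hC.
  rewrite !seriesEord/= (le_trans (ler_norm_sum _ _ _))// ler_sum// => i _.
  have /andP[xs0 xs1] := onemM_gt0 x01 s01.
  rewrite normrM (ger0_norm (exprn_ge0 _ xs0)) ler_wpM2l//.
  rewrite lerXn2r ?nnegrE// ler_piMr//; move: s01 => /andP[_ /ltW]; exact.
have [ieu _ cv] := @dominated_convergence _ _ R mu `]0, 1[%classic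
  (measurable_itv `]0, 1[) _ _ _ mf_ mf ff ig fg.
split => //; apply: (cvg_unique _ cv); first exact: ereal_hausdorff.
suff : (fun n => \int[mu]_(s in `]0%R, 1%R[) f_ n s)%E @ \oo -->
    (betaf z y * hyp2F1 z b (z + y) x)%:E by [].
rewrite (funext int_f); apply: cvg_EFin; first exact: nearW.
by apply: cvgMr; apply: is_cvg_hyp2F1 => //; rewrite lerDl ltW.
Qed.

End euler.

(** * Substituting a power *)

Section power_substitution.
Context {R : realType}.
Implicit Types (a b q x y z t : R).
Notation mu := (@lebesgue_measure R).

Lemma powR_in01 q t : 0 < q -> 0 < t < 1 -> 0 < t `^ q < 1.
Proof.
move=> q0 /andP[t0 t1]; rewrite powR_gt0//=.
have : t `^ q < 1 `^ q by apply: gt0_ltr_powR; rewrite ?nnegrE ?(ltW t0).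
by rewrite powR1.
Qed.

(** [euler_kernel] transported by s = t^q, up to the factor q. At z = 1/q the first power is
    trivial, which makes both the elliptic integrand and that of pi_{p,q} instances. *)
Definition pow_kernel q z y b x t : R :=
  t `^ (q * z - 1) * (1 - t `^ q) `^ (y - 1) * (1 - x * t `^ q) `^ (- b).

(** With [x = 1] included, this serves both 1 - t^q and 1 - k^q t^q. *)
Lemma onemM_powR_continuous q x a : 0 < q -> 0 <= x <= 1 ->
  {in `]0, 1[, continuous (fun t : R => (1 - x * t `^ q) `^ a)}.
Proof.
move=> q0 /andP[x0 x1] t; rewrite in_itv/= => t01.
have /andP[tq0 tq1] := powR_in01 q0 t01.
apply: (@continuous_comp _ _ _ (fun t => x * t `^ q) (fun s => (1 - s) `^ a)).
  by apply: cvgMr; apply: powR_continuous; case/andP: t01.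
by apply: onem_powR_continuous; rewrite (le_lt_trans _ tq1)// ler_piMl// ltW.
Qed.

Lemma pow_kernel_continuous q z y b x : 0 < q -> 0 <= x <= 1 ->
  {in `]0, 1[, continuous (pow_kernel q z y b x)}.
Proof.
move=> q0 x01 t t01; apply: cvgM; last exact: onemM_powR_continuous.
apply: cvgM; first by apply: powR_continuous; move: t01; rewrite in_itv/= => /andP[].
have := @onemM_powR_continuous q 1 (y - 1) q0 _ t t01.
by under eq_fun do rewrite mul1r; apply; rewrite ler01 lexx.
Qed.

Lemma pow_kernelE q z y b x t : 0 < q -> 0 < t ->
  euler_kernel z y b x (t `^ q) * (q * t `^ (q - 1)) = q * pow_kernel q z y b x t.
Proof.
move=> q0 t0; rewrite /euler_kernel /beta_kernel /pow_kernel -powRrM.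
rewrite (_ : q * z - 1 = q * (z - 1) + (q - 1)); last by ring.
by rewrite [t `^ (q * (z - 1) + _)]powRD ?(gt_eqF t0) ?implybT//; ring.
Qed.

Lemma integral_pow_kernel q z y b x : 0 < q -> 0 < z -> 0 < y -> 0 <= x < 1 ->
  mu.-integrable `](0 : R), (1 : R)[ (EFin \o pow_kernel q z y b x) /\
  (\int[mu]_(t in `]0%R, 1%R[) (pow_kernel q z y b x t)%:E =
   (q^-1 * (betaf z y * hyp2F1 z b (z + y) x))%:E)%E.
Proof.
move=> q0 z0 y0 x01.
have x01' : 0 <= x <= 1 by case/andP: x01 => -> /ltW.
have mk : measurable_fun `](0 : R), (1 : R)[ (pow_kernel q z y b x).
  by apply: continuous_oo_measurable; exact: pow_kernel_continuous.
have k0 t : 0 <= pow_kernel q z y b x t by rewrite !mulr_ge0 ?powR_ge0.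
have [iE IE] := euler_integral b z0 y0 x01.
(* The kernel is nonnegative, so its finite integral already proves integrability. *)
suff I : (\int[mu]_(t in `]0%R, 1%R[) (pow_kernel q z y b x t)%:E =
   (q^-1 * (betaf z y * hyp2F1 z b (z + y) x))%:E)%E.
  split => //; apply/integrableP; split; first exact: measurableT_comp.
  under eq_integral do rewrite /= ger0_norm//.
  by rewrite I ltry.
rewrite EFinM -IE.
rewrite -(@increasing_ge0_integration_by_substitution_oo R
    (euler_kernel z y b x) (fun t => t `^ q) (fun t => q * t `^ (q - 1)) 0 1)//.
- under [in RHS]eq_integral => t.
    rewrite inE/= in_itv/= => /andP[t0 _]; rewrite pow_kernelE// EFinM; over.
  rewrite ge0_integralZl//=.
  + by rewrite muleA -EFinM mulVf ?gt_eqF// mul1e.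
  + exact: measurableT_comp.
  + by move=> t _; rewrite lee_fin.
  + by rewrite lee_fin ltW.
- exact: euler_kernel_continuous.
- by move=> s _; exact: euler_kernel_ge0.
- move=> t; rewrite in_itv/= => /andP[t0 _]; apply: cvgMr.
  exact: powR_continuous.
- by move=> t _; rewrite mulr_ge0 ?powR_ge0// ltW.
- by move=> t; rewrite !in_itv/=; exact: powR_in01.
- by move=> t; rewrite in_itv/= => /andP[t0 _]; exact: is_derive1_powR.
- exact: powR_cvg0.
- exact: powR_cvg_at_left1.
Qed.

End power_substitution.

(** * The constants pi_{p,q} as values of the beta function *)

Section generalized_pi.
Context {R : realType}.
Implicit Types (p q u v : R).
Notation mu := (@lebesgue_measure R).

Lemma hyp2F1_b0 (a c x : R) : hyp2F1 a 0 c x = 1.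
Proof.
apply/cvg_lim => //; rewrite -cvg_shiftS; apply: cvg_near_cst; near=> n.
rewrite /= seriesEord/= big_ord_recl/= !poch0 expr0 fact0 !mulr1 divr1.
by rewrite big1 ?addr0// => i _; rewrite [poch 0 _]pochSl mul0r mulr0 !mul0r.
Unshelve. all: by end_near. Qed.

Lemma conjrV p : 1 < p -> (conjr p)^-1 = 1 - p^-1.
Proof.
move=> p1; rewrite /conjr /hoelder_conjugate/=.
rewrite eqe (gt_eqF (lt_trans ltr01 p1)) -EFinD inver subr_eq0 (gt_eqF p1) -EFinM/=.
by rewrite invfM invrK mulrBr mulVf ?mulr1 ?gt_eqF// (lt_trans ltr01).
Qed.

(** At [u = 1] the conventional value is twice p/(p-1) = B(1, 1 - 1/p). Otherwise the integral is
    that of a [pow_kernel] with z = 1/u and b = x = 0, where the hypergeometric factor is 1. *)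
Lemma gpi_betaf p u : 1 < p -> 1 <= u ->
  gpi p%:E u / 2 = u^-1 * betaf u^-1 (1 - p^-1).
Proof.
move=> p1 u1; have p0 := lt_trans ltr01 p1.
have y0 : 0 < 1 - p^-1 by rewrite subr_gt0 invf_lt1.
rewrite /gpi; case: eqVneq => [->|_].
  rewrite mulrAC divff ?pnatr_eq0// mul1r invr1 mul1r.
  by rewrite betaf1l// -conjrV// invrK.
rewrite mulrAC divff ?pnatr_eq0// mul1r.
have u0 := lt_le_trans ltr01 u1.
have iu0 : 0 < u^-1 by rewrite invr_gt0.
have x01 : 0 <= (0 : R) < 1 by rewrite lexx ltr01.
have [_ I] := integral_pow_kernel 0 u0 iu0 y0 x01.
have e t : (1 - t `^ u) `^ (- p^-1) = pow_kernel u u^-1 (1 - p^-1) 0 0 t.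
  rewrite /pow_kernel divff ?gt_eqF// subrr powRr0 mul1r.
  by rewrite oppr0 powRr0 mulr1; congr (_ `^ _); ring.
rewrite /Rintegral (@integral_itv_bndoo _ 0 1 _ true false)//.
  by under eq_integral do rewrite e; rewrite I/= hyp2F1_b0 mulr1.
apply: measurableT_comp => //; rewrite (funext e); apply: continuous_oo_measurable.
by apply: pow_kernel_continuous; rewrite ?lexx ?ler01.
Qed.

(** At [v = 1] the conjugate is infinite and the conventional value 2 agrees with B(1/q, 1) = q. For
    [v > 1] the conjugate s satisfies 1 - 1/s = 1/v. *)
Lemma gpi_conj_betaf v q : 1 <= v -> 1 < q ->
  gpi (hoelder_conjugate v%:E) q / 2 = q^-1 * betaf q^-1 v^-1.
Proof.
move=> v1 q1; have q0 := lt_trans ltr01 q1.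
move: v1; rewrite le_eqVlt => /predU1P[<-|v1].
  rewrite hoelder_conjugate1 /= divff ?pnatr_eq0// invr1 betaf1r ?invr_gt0//.
  by rewrite divff// invr_eq0 gt_eqF.
have v0 := lt_trans ltr01 v1.
rewrite /hoelder_conjugate/= eqe (gt_eqF v0) -EFinD inver subr_eq0 (gt_eqF v1).
rewrite -EFinM.
rewrite gpi_betaf ?ltW//.
  congr (_ * betaf _ _); field.
  by rewrite subr_eq0 !gt_eqF.
by rewrite ltr_pdivlMr ?subr_gt0// mul1r gtrBl.
Qed.

End generalized_pi.

(** * Jacobi functions *)

Lemma powR_lt1 (R : realType) (k q : R) : 0 < q -> 0 <= k < 1 -> 0 <= k `^ q < 1.
Proof.
move=> q0 /andP[k0 k1]; rewrite powR_ge0/=.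
have : k `^ q < 1 `^ q by apply: gt0_ltr_powR; rewrite ?nnegrE.
by rewrite powR1.
Qed.

(** Holds at every t, which allows rewriting [ellH] as a function: at the singular point t = 1, for
    p > 0, the inverse of 0 and a negative power of 0 are both 0. *)
Lemma ellH_kernelE (R : realType) (p q r k t : R) : 0 < q ->
  ((1 - t `^ q) `^ p^-1 * (1 - k `^ q * t `^ q) `^ (1 - r^-1))^-1 =
  pow_kernel q q^-1 (1 - p^-1) (1 - r^-1) (k `^ q) t.
Proof.
move=> q0; rewrite /pow_kernel divff ?gt_eqF// subrr powRr0 mul1r invfM -!powRN.
by congr (_ `^ _ * _); ring.
Qed.

(** The parameters start at (z, y, b) = (1/q, 1 - 1/p, 1 - 1/r) for [g = 1]; a power of sn changes
    only z, one of cn only y, one of dn only b. *)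
Lemma integral_comp_sn (R : realType) (p q r k : R) (g : R -> R) (z y b : R) :
  1 < p -> 1 < q -> 0 <= k < 1 -> 0 < z -> 0 < y ->
  {in `]0, 1[, continuous g} -> {in `]0, 1[, forall x, 0 <= g x} ->
  {in `]0, 1[, forall x, g x * pow_kernel q q^-1 (1 - p^-1) (1 - r^-1) (k `^ q) x =
    pow_kernel q z y b (k `^ q) x} ->
  (\int[@lebesgue_measure R]_(t in `[0%R, ellK p q r k])
     (g (sn p q r t k))%:E
   = (q^-1 * (betaf z y * hyp2F1 z b (z + y) (k `^ q)))%:E)%E.
Proof.
move=> p1 q1 k01 z0 y0 cg g0 gE.
have q0 := lt_trans ltr01 q1.
have kq := powR_lt1 q0 k01; have kq' : 0 <= k `^ q <= 1 by case/andP: kq => -> /ltW.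
have [iE IE] := integral_pow_kernel b q0 z0 y0 kq.
have iq0 : 0 < q^-1 by rewrite invr_gt0.
have ip0 : 0 < 1 - p^-1 by rewrite subr_gt0 invf_lt1// (lt_trans ltr01).
have [ih _] := integral_pow_kernel (1 - r^-1) q0 iq0 ip0 kq.
have HE y' : ellH p q r y' k = \int[@lebesgue_measure R]_(t in `[0, y'])
    pow_kernel q q^-1 (1 - p^-1) (1 - r^-1) (k `^ q) t.
  by apply: eq_Rintegral => t _; exact: ellH_kernelE.
rewrite /ellK HE /sn (funext HE).
rewrite integral_comp_pinv_primitive//.
- rewrite -IE; apply: eq_integral => t; rewrite inE => t01.
  by rewrite gE.
- exact: pow_kernel_continuous.
- move=> t; rewrite in_itv/= => t01; have /andP[tq0 tq1] := powR_in01 q0 t01.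
  rewrite /pow_kernel !mulr_gt0// powR_gt0//; first by case/andP: t01.
    by rewrite subr_gt0.
  by rewrite subr_gt0 (le_lt_trans _ tq1)// ler_piMl ?ltW//; case/andP: kq.
- by apply: eq_integrable iE => // t; rewrite inE/= => t01; rewrite gE.
Qed.

Theorem theorem4p4 (R : realType) (p q r k : R) (n : nat)
    (hp : 1 < p) (hq : 1 < q) (hr : 1 < r) (hk : 0 <= k < 1) :
  [/\ (forall a u : R, -1 < a <= q - 1 -> u^-1 = (a + 1) / q ->
        (\int[@lebesgue_measure R]_(t in `[0%R, ellK p q r k])
           (sn p q r t k `^ (q * n%:R + a))%:E)%E
        = (poch u^-1 n / ((a + 1) * poch ((conjr p)^-1 + u^-1) n)
           * (gpi p%:E u / 2)
           * hyp2F1 (u^-1 + n%:R) (conjr r)^-1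
               ((conjr p)^-1 + u^-1 + n%:R) (k `^ q))%:E),
      (forall a v : R, 1 - p < a <= 1 -> v^-1 = (a + p - 1) / p ->
        (\int[@lebesgue_measure R]_(t in `[0%R, ellK p q r k])
           (cn p q r t k `^ (p * n%:R + a))%:E)%E
        = (poch v^-1 n / poch (q^-1 + v^-1) n
           * (gpi (hoelder_conjugate v%:E) q / 2)
           * hyp2F1 q^-1 (conjr r)^-1
               (q^-1 + v^-1 + n%:R) (k `^ q))%:E)
    & (forall c : R,
        (\int[@lebesgue_measure R]_(t in `[0%R, ellK p q r k])
           (dn p q r t k `^ c)%:E)%E
        = (gpi p%:E q / 2
           * hyp2F1 q^-1 ((1 - c) / conjr r)
               ((conjr p)^-1 + q^-1) (k `^ q))%:E)].
Proof.
have p0 := lt_trans ltr01 hp; have q0 := lt_trans ltr01 hq.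
have iq0 : 0 < q^-1 by rewrite invr_gt0.
have ip0 : 0 < p^-1 by rewrite invr_gt0.
have y0 : 0 < 1 - p^-1 by rewrite subr_gt0 invf_lt1.
have kq := powR_lt1 q0 hk; have kq' : 0 <= k `^ q <= 1 by case/andP: kq => -> /ltW.
rewrite !conjrV//; split.
- move=> a u /andP[a0 a1] uE.
  have a10 : 0 < a + 1 by lra.
  have u0 : 0 < u^-1 by rewrite uE divr_gt0.
  (* This is where [a <= q - 1] enters; equality gives [u = 1], the conventional value of pi. *)
  have u1 : 1 <= u.
    by rewrite -(invrK u) uE invf_div ler_pdivlMr// mul1r; lra.
  rewrite (@integral_comp_sn _ p q r k (fun x => x `^ (q * n%:R + a))
    (u^-1 + n%:R) (1 - p^-1) (1 - r^-1))//.
  + rewrite betaf_addnl// gpi_betaf//; congr EFin.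
    rewrite [1 - p^-1 + u^-1]addrC (addrAC u^-1).
    (* The factor 1/q comes from s = t^q, whereas pi_{p,u} / 2 carries 1/u; their quotient is the a
       + 1 in the denominator. *)
    have -> : q^-1 = u^-1 / (a + 1) by rewrite uE; field; rewrite !gt_eqF.
    by rewrite invfM; ring.
  + by rewrite ltr_wpDr.
  + by move=> x; rewrite in_itv/= => /andP[x0 _]; exact: powR_continuous.
  + by move=> x _; exact: powR_ge0.
  + move=> x; rewrite in_itv/= => /andP[x0 x1].
    rewrite /pow_kernel divff ?gt_eqF// subrr powRr0 mul1r mulrA.
    congr (_ `^ _ * _ * _).
    by rewrite mulrDr uE; field; rewrite gt_eqF.
- move=> a v /andP[a0 a1] vE.
  have v0 : 0 < v^-1 by rewrite vE divr_gt0//; lra.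
  have v1 : 1 <= v.
    by rewrite -(invrK v) vE invf_div ler_pdivlMr ?mul1r; lra.
  (* The factor [1 *] brings the base into the form of [onemM_powR_continuous] at [x = 1]. *)
  have cnE x : ((1 - x `^ q) `^ p^-1) `^ (p * n%:R + a) =
      (1 - 1 * x `^ q) `^ (p^-1 * (p * n%:R + a)) by rewrite powRrM mul1r.
  rewrite (@integral_comp_sn _ p q r k
    (fun x => ((1 - x `^ q) `^ p^-1) `^ (p * n%:R + a))
    q^-1 (v^-1 + n%:R) (1 - r^-1))//.
  + rewrite betaf_addnr// gpi_conj_betaf//; congr EFin.
    by rewrite addrA; ring.
  + by rewrite ltr_wpDr.
  + by rewrite (funext cnE); apply: onemM_powR_continuous => //; rewrite ler01 lexx.
  + by move=> x _; exact: powR_ge0.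
  + move=> x; rewrite in_itv/= => x01; have /andP[xq0 xq1] := powR_in01 q0 x01.
    rewrite cnE mul1r /pow_kernel divff ?gt_eqF// subrr powRr0 !mul1r mulrA.
    (* The exponents of 1 - x^q add up to (n + a/p) - 1/p = (1/v + n) - 1. *)
    rewrite -powRD; last by rewrite subr_eq0 (gt_eqF xq1) implybT.
    congr (_ `^ _ * _).
    by rewrite vE; field; rewrite gt_eqF.
- move=> c.
  have dnE x : ((1 - k `^ q * x `^ q) `^ (1 - r^-1)) `^ c =
      (1 - k `^ q * x `^ q) `^ ((1 - r^-1) * c) by rewrite powRrM.
  rewrite (@integral_comp_sn _ p q r k
    (fun x => ((1 - k `^ q * x `^ q) `^ (1 - r^-1)) `^ c)
    q^-1 (1 - p^-1) ((1 - c) * (1 - r^-1)))//.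
  + rewrite gpi_betaf ?(ltW hq)//; congr EFin.
    by rewrite [_ + q^-1]addrC; ring.
  + by rewrite (funext dnE); exact: onemM_powR_continuous.
  + by move=> x _; exact: powR_ge0.
  + move=> x; rewrite in_itv/= => x01; have /andP[xq0 xq1] := powR_in01 q0 x01.
    rewrite dnE /pow_kernel mulrC -!mulrA; congr (_ * (_ * _)).
    (* With w = 1 - 1/r, the exponents of 1 - k^q x^q add up to w c - w = -(1 - c) w. *)
    rewrite -powRD.
      by congr (_ `^ _); ring.
    apply/implyP => _; rewrite subr_eq0 gt_eqF//.
    by rewrite (le_lt_trans _ xq1)// ler_piMl ?ltW//; case/andP: kq.
Qed.
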